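(* Let $a\in(\tfrac12,1)$ and $b=\frac{1}{a-1}$. Then every positive periodic smooth solution $F:\mathbb{R}\to(0,\infty)$ of the equation $$F'''=-2(2+b)F^{b}F'$$ is constant. *)

(* Defs.v *)
From Stdlib Require Import Reals.
From Coquelicot Require Import Coquelicot.
Open Scope R_scope.

Definition smooth (F : R -> R) : Prop := forall (n : nat) (x : R), ex_derive_n F n x.

Definition periodic (F : R -> R) : Prop :=
  exists T : R, 0 < T /\ forall x : R, F (x + T) = F x.

(* Main.v *)
Require Import Defs.
From Stdlib Require Import ZArith Reals Lra Lia.
From Coquelicot Require Import Coquelicot.
Open Scope R_scope.

(** Here [b < -2], so the equation integrates to
    [F'' = K - 2(2+b)/(b+1) F^(b+1)], whose right-hand side is a strictly
    increasing function of [F].  At a maximum of [F] it is [<= 0] and at a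
    minimum it is [>= 0], so the maximum does not exceed the minimum. *)

Lemma period_IZR (F : R -> R) (T : R) (n : Z) (x : R) :
  (forall y, F (y + T) = F y) -> F (x + IZR n * T) = F x.
Proof.
intros hF.
assert (hnat : forall (k : nat) y, F (y + INR k * T) = F y).
{ induction k as [|k IH]; intros y.
  - simpl; f_equal; ring.
  - rewrite S_INR, <- (IH y), <- (hF (y + INR k * T)); f_equal; ring. }
destruct (Z.le_gt_cases 0 n) as [hn|hn].
- rewrite <- (Z2Nat.id n hn), <- INR_IZR_INZ; apply hnat.
(* For negative [n], moving forward by [- n] periods from [x + IZR n * T] returns to [x]. *)
- rewrite <- (hnat (Z.to_nat (- n)) (x + IZR n * T)).
  rewrite INR_IZR_INZ, Z2Nat.id by lia.
  rewrite opp_IZR; f_equal; ring.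
Qed.

Lemma period_representative (T x : R) :
  0 < T -> exists n : Z, 0 <= x + IZR n * T <= T.
Proof.
intros hT; destruct (archimed (x / T)) as [h1 h2].
(* [up q] lies in [(q, q + 1]], so [q + 1 - up q] lies in [[0, 1)]; here [q = x / T], and the result
   is scaled by [T]. *)
exists (1 - up (x / T))%Z; rewrite minus_IZR.
set (u := IZR (up (x / T))) in *.
replace x with (x / T * T) by (field; lra).
set (q := x / T) in *; nra.
Qed.

Lemma continuous_periodic_max (F : R -> R) :
  (forall x, continuity_pt F x) -> periodic F ->
  exists M, forall x, F x <= F M.
Proof.
intros hc [T [hT hper]].
destruct (continuity_ab_maj F 0 T (Rlt_le _ _ hT) (fun c _ => hc c))
  as [M [hM _]].
exists M; intros x.
destruct (period_representative T x hT) as [n hn].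
rewrite <- (period_IZR F T n x hper); now apply hM.
Qed.

(** Since [f'] vanishes at [x0], a positive second derivative would make [f'] positive just to the
    right of [x0], whereas the mean value theorem finds a point there with [f' <= 0]. *)
Lemma Derive_2_at_max (f : R -> R) (x0 : R) :
  (forall x, ex_derive f x) -> ex_derive (Derive f) x0 ->
  (forall x, f x <= f x0) -> Derive (Derive f) x0 <= 0.
Proof.
intros hf hf' hmax.
assert (h0 : Derive f x0 = 0).
{ rewrite <- (Derive_Reals f x0 (ex_derive_Reals_0 _ _ (hf x0))).
  apply (deriv_maximum f (x0 - 1) (x0 + 1)); try lra.
  intros; apply hmax. }
apply Rnot_lt_le; intros hpos.
assert (hd : derivable_pt_lim (Derive f) x0 (Derive (Derive f) x0)).
{ now apply is_derive_Reals, Derive_correct. }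
(* The tolerance is the second derivative itself, so difference quotients of [f'] within distance
   [d] of [x0] are positive; the step [d / 2] below keeps [c] in that range. *)
destruct (hd _ hpos) as [[d hd0] hdelta]; simpl in hdelta.
destruct (MVT_cor2 f (Derive f) x0 (x0 + d / 2)) as [c [hc1 hc2]].
- lra.
- intros x _; apply is_derive_Reals, Derive_correct, hf.
- specialize (hmax (x0 + d / 2)).
  assert (hc3 : Derive f c <= 0) by nra.
  specialize (hdelta (c - x0)).
  rewrite Rabs_pos_eq in hdelta by lra.
  specialize (hdelta ltac:(lra) ltac:(lra)).
  replace (x0 + (c - x0)) with c in hdelta by ring.
  rewrite h0, Rminus_0_r in hdelta.
  apply Rabs_def2 in hdelta.
  assert (hq : 0 < Derive f c / (c - x0)) by lra.
  apply (Rmult_lt_compat_r (c - x0)) in hq; [|lra].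
  unfold Rdiv in hq; rewrite Rmult_assoc, Rinv_l in hq by lra; lra.
Qed.

Lemma Derive_2_at_min (f : R -> R) (x0 : R) :
  (forall x, ex_derive f x) -> ex_derive (Derive f) x0 ->
  (forall x, f x0 <= f x) -> 0 <= Derive (Derive f) x0.
Proof.
intros hf hf' hmin.
assert (hopp : forall x, - Derive f x = Derive (fun y => - f y) x).
{ intros x; symmetry; apply Derive_opp. }
enough (h : Derive (Derive (fun y => - f y)) x0 <= 0).
{ rewrite <- (Derive_ext _ _ x0 hopp), Derive_opp in h; lra. }
apply Derive_2_at_max.
- intros x; apply (ex_derive_opp f x (hf x)).
- apply (ex_derive_ext _ _ _ hopp), (ex_derive_opp (Derive f) x0 hf').
- intros x; apply Ropp_le_contravar, hmin.
Qed.

Lemma Derive_0_const (f : R -> R) (x y : R) :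
  (forall t, is_derive f t 0) -> f x = f y.
Proof.
intros hf; destruct (Rtotal_order x y) as [h|[->|h]]; [|reflexivity|symmetry];
  apply (eq_is_derive f); auto.
Qed.

Lemma Rpower_neg_lt (x y p : R) :
  p < 0 -> 0 < x < y -> Rpower y p < Rpower x p.
Proof.
intros hp hxy.
replace p with (- - p) by ring; rewrite 2!(Rpower_Ropp _ (- p)).
apply Rinv_lt_contravar.
- apply Rmult_lt_0_compat; apply exp_pos.
- apply Rlt_Rpower_l; lra.
Qed.

(** By the chain rule, the derivative of [F'' - C / (b + 1) * F^(b + 1)] is [F''' - C * F^b * F'],
    which the equation makes zero. Positivity of [F] gives the power rule for [Rpower]. *)
Lemma first_integral (F : R -> R) (b C x y : R) :
  b + 1 <> 0 -> (forall t, 0 < F t) -> smooth F ->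
  (forall t, Derive_n F 3 t = C * Rpower (F t) b * Derive F t) ->
  Derive_n F 2 x - C / (b + 1) * Rpower (F x) (b + 1) =
  Derive_n F 2 y - C / (b + 1) * Rpower (F y) (b + 1).
Proof.
intros hb hpos hF heq.
apply (Derive_0_const
  (fun t => Derive_n F 2 t - C / (b + 1) * Rpower (F t) (b + 1))).
intros t.
replace 0 with (Derive_n F 3 t
  - C / (b + 1) * (Derive F t * ((b + 1) * Rpower (F t) (b + 1 - 1)))).
- apply (is_derive_minus (Derive_n F 2)
    (fun t => C / (b + 1) * Rpower (F t) (b + 1))).
  + exact (Derive_correct _ _ (hF 3%nat t)).
  + apply (is_derive_scal (fun t => Rpower (F t) (b + 1))).
    apply (is_derive_comp (fun u => Rpower u (b + 1)) F).
    * apply is_derive_Reals, derivable_pt_lim_power, hpos.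
    * exact (Derive_correct _ _ (hF 1%nat t)).
- rewrite heq; replace (b + 1 - 1) with b by ring; field; exact hb.
Qed.

Theorem proposition3p8 (a b : R) (ha : 1 / 2 < a < 1) (hb : b = 1 / (a - 1))
  (F : R -> R) (Fpos : forall x : R, 0 < F x) (Fsmooth : smooth F)
  (Fper : periodic F)
  (Feq : forall x : R,
     Derive_n F 3 x = - 2 * (2 + b) * Rpower (F x) b * Derive F x) :
  exists c : R, forall x : R, F x = c.
Proof.
(* [a - 1] lies in [(-1/2, 0)], so its reciprocal is below [-2]. *)
assert (hb2 : b < - 2).
{ assert (b * (a - 1) = 1) by (rewrite hb; field; lra); nra. }
assert (hd : forall x, ex_derive F x) by exact (Fsmooth 1%nat).
assert (hd2 : forall x, ex_derive (Derive F) x) by exact (Fsmooth 2%nat).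
assert (hc : forall x, continuity_pt F x).
{ intros x; apply derivable_continuous_pt, ex_derive_Reals_0, hd. }
destruct (continuous_periodic_max F hc Fper) as [M hM].
(* A minimum of [F] is obtained as a maximum of [- F]. *)
destruct (continuous_periodic_max (fun x => - F x)) as [m hm].
{ intros x; apply (continuity_pt_opp F), hc. }
{ destruct Fper as [T [hT hper]]; exists T; split; [exact hT|].
  intros x; now rewrite hper. }
assert (hmin : forall x, F m <= F x) by (intros x; specialize (hm x); lra).
pose proof (Derive_2_at_max F M hd (hd2 M) hM) as hM2.
pose proof (Derive_2_at_min F m hd (hd2 m) hmin) as hm2.
assert (hb1 : b + 1 <> 0) by lra.
pose proof (first_integral F b (- 2 * (2 + b)) M m hb1 Fpos Fsmooth Feq) as hI.
change (Derive_n F 2) with (Derive (Derive F)) in hI.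
(* From [b < -2], the numerator is positive and the denominator negative. *)
assert (hk : - 2 * (2 + b) / (b + 1) < 0).
{ unfold Rdiv; assert (/ (b + 1) < 0) by (apply Rinv_lt_0_compat; lra); nra. }
assert (hMm : F M <= F m).
{ apply Rnot_lt_le; intros hlt.
  (* The exponent [b + 1] and the coefficient in [hk] are both negative, so [F m < F M] would force
     [F''] to be strictly larger at [M] than at [m], against [hM2] and [hm2]. *)
  pose proof (Rpower_neg_lt (F m) (F M) (b + 1) ltac:(lra)
    (conj (Fpos m) hlt)).
  nra. }
exists (F m); intros x; specialize (hM x); specialize (hmin x); lra.
Qed.
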